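(* For every fixed real $p\geq 2$ and every fixed integer $k\geq 1$, the function $$\phi(k,p,n)=\max\left\{\sum_{u\in V(G)}d_G^p(u) : G \text{ is a graph of order } n \text{ containing no } C_{2k+2}\right\}$$ satisfies $$\phi(k,p,n)=kn^p(1+o(1))\quad\text{as } n\to\infty,$$ that is, $\lim_{n\to\infty}\phi(k,p,n)/n^p=k$.
   Context: Graphs are finite, simple and undirected. The order of a graph is its number of vertices. $C_l$ denotes the cycle of length $l$; ''$G$ contains no $C_{2k+2}$'' means that $G$ has no (not necessarily induced) subgraph isomorphic to $C_{2k+2}$. $d_G(u)$ denotes the degree of the vertex $u$ in $G$, and $d_G^p(u)=(d_G(u))^p$. *)

(* Defs.v *)
From HB Require Import structures.
From mathcomp Require Import all_boot all_order all_algebra.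
From mathcomp Require Import all_classical all_reals all_analysis.

Set Implicit Arguments.
Unset Strict Implicit.
Unset Printing Implicit Defensive.

Import Order.TTheory GRing.Theory Num.Theory.

Local Open Scope ring_scope.

(* A simple graph on [T] is given by its adjacency relation, stored as the set
   of ordered adjacent pairs, so that the graphs on [T] form a finite type. *)
Definition simple_adjacency (T : finType) (A : {set T * T}) : bool :=
  [forall u, (u, u) \notin A]
  && [forall u, forall v, ((u, v) \in A) == ((v, u) \in A)].

Record sgraph (T : finType) := SGraph {
  adj_pairs : {set T * T};
  adj_pairsP : simple_adjacency adj_pairs }.

HB.instance Definition _ (T : finType) := [isSub for @adj_pairs T].
HB.instance Definition _ (T : finType) := [Finite of sgraph T by <:].

Definition adj (T : finType) (G : sgraph T) : rel T :=
  [rel u v | (u, v) \in adj_pairs G].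

Definition degree (T : finType) (G : sgraph T) (u : T) : nat :=
  #|[set v | adj G u v]|.

(* Successive residues modulo [l] are adjacent; a simple graph for [l >= 3]. *)
Definition cycle_adj (l : nat) : rel 'I_l :=
  [rel i j : 'I_l | (j == i.+1 %[mod l]) || (i == j.+1 %[mod l])].

(* Not necessarily induced: edges are preserved, non-edges need not be. *)
Definition contains_subgraph (S T : finType) (H : rel S) (G : rel T) : bool :=
  [exists f : {ffun S -> T},
     injectiveb f && [forall x, forall y, H x y ==> G (f x) (f y)]].

Definition contains_cycle (T : finType) (l : nat) (G : sgraph T) : bool :=
  contains_subgraph (@cycle_adj l) (adj G).

Definition degree_power_sum (R : realType) (T : finType) (p : R)
    (G : sgraph T) : R :=
  \sum_(u : T) (degree G u)%:R `^ p.

(* Every graph of order [n] is isomorphic to one on ['I_n]. The initial value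
   0 does not affect the maximum: the sums are nonnegative and, for [k >= 1],
   the edgeless graph contains no cycle of length [2 * k + 2]. *)
Definition phi (R : realType) (k : nat) (p : R) (n : nat) : R :=
  \big[Num.max/0]_(G : sgraph 'I_n | ~~ contains_cycle (2 * k + 2) G)
    degree_power_sum p G.

(* Main.v *)
Require Import Defs.
From HB Require Import structures.
From mathcomp Require Import all_boot all_order all_algebra.
From mathcomp Require Import all_classical all_reals all_analysis.
From mathcomp Require Import zify ring lra.

Set Implicit Arguments.
Unset Strict Implicit.
Unset Printing Implicit Defensive.

Import Order.TTheory GRing.Theory Num.Theory.
Import numFieldNormedType.Exports.

(** Since degrees are below [n], [d ^ p <= n ^ (p - 2) * d ^ 2], so the upper
    bound for every [p >= 2] follows from the case of squares: the degree square
    sum is at most [k * n ^ 2 + o(n ^ 2)].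

    The sum of squares is the sum, over the vertices [u], of the degrees of the
    neighbours of [u]. Fix [u], let [A] be its neighbourhood and [B] the set of
    the vertices other than [u] outside [A]. A path on [2k + 1] vertices that avoids [u] and has
    both ends in [A] closes up through [u] into a [C_{2k+2}]. Without such a
    path there are at most [k * |B| + 2k * |A|] edges between [A] and [B], and
    at most a constant times [|A|] inside [A] ([edges_near_vertex]): a denser
    pair contains a subpair all of whose degrees are large ([dense_core]), in
    which the path is built greedily ([alternating_path]). The coefficient of
    [|B|] is exactly [k] because an alternating path uses only [k + 1] vertices
    of [A], and this coefficient becomes the limit. Summing over [u],
    [degree_square_sum] bounds the square sum by [k * n ^ 2] plus a constant
    times the degree sum; this inequality itself forces the degree sum to be
    [O(n ^ (3/2))] ([degree_square_sum_bound]).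

    For the lower bound, join [k] mutually adjacent vertices to all the others.
    Those [k] vertices meet every edge and have degree [n - 1], whereas
    [C_{2k+2}] has [k + 1] disjoint edges, hence no cover by [k] vertices. *)

Local Open Scope nat_scope.

(** * Dense pairs of vertex sets *)

(** Edges with both ends in [A :&: W] count twice, once for each orientation;
    thus one notion serves both for bipartite pairs and for [A = W]. *)
Definition edges_between (T1 T2 : finType) (e : T1 -> T2 -> bool)
    (A : {set T1}) (W : {set T2}) : nat :=
  \sum_(a in A) \sum_(w in W) e a w.

(** Deleting a vertex of [A] with at most [t] neighbours, or one of [W] with at
    most [s], preserves the hypothesis; it fails for empty sets, so the deletion
    process stops at a nonempty pair. *)
Lemma dense_core (T1 T2 : finType) (e : T1 -> T2 -> bool) (s t : nat)
    (A : {set T1}) (W : {set T2}) :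
  s * #|W| + t * #|A| < edges_between e A W ->
  exists (A' : {set T1}) (W' : {set T2}), [/\ A' \subset A, W' \subset W, 0 < #|A'|,
    forall a, a \in A' -> t < \sum_(w in W') e a w &
    forall w, w \in W' -> s < \sum_(a in A') e a w].
Proof.
move: {2}(#|A| + #|W|) (leqnn (#|A| + #|W|)) => m.
elim: m A W => [|m IHm] A W.
  rewrite leqn0 addn_eq0 !cards_eq0 => /andP[/eqP-> /eqP->].
  by rewrite /edges_between big_set0.
move=> lem dense.
have [/exists_inP[a aA low]|/exists_inPn highA] :=
  boolP [exists a in A, \sum_(w in W) e a w <= t].
  have cA := cardsD1 a A; rewrite aA in cA.
  have [||A' [W' [sA sW A0 dA dW]]] := IHm (A :\ a) W.
  - by clear -lem cA; lia.
  - move: dense; rewrite /edges_between (big_setD1 a aA) /=; nia.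
  - exists A', W'; split=> //; exact: fintype.subset_trans sA (finset.subsetDl _ _).
have [/exists_inP[w wW low]|/exists_inPn highW] :=
  boolP [exists w in W, \sum_(a in A) e a w <= s].
  have cW := cardsD1 w W; rewrite wW in cW.
  have [||A' [W' [sA sW A0 dA dW]]] := IHm A (W :\ w).
  - by clear -lem cW; lia.
  - move: dense; rewrite /edges_between.
    under eq_bigr do rewrite (big_setD1 w wW) /=.
    rewrite big_split /=; nia.
  - exists A', W'; split=> //; exact: fintype.subset_trans sW (finset.subsetDl _ _).
exists A, W; split=> //.
- rewrite lt0n cards_eq0; apply: contraTneq dense => ->.
  by rewrite /edges_between big_set0.
- by move=> a /highA; rewrite -ltnNge.
- by move=> w /highW; rewrite -ltnNge.
Qed.

Lemma fresh_neighbour (T : finType) (P : pred T) (W : {set T}) (p : seq T) :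
  count [in W] p < \sum_(w in W) P w ->
  exists w, [/\ w \in W, P w & w \notin p].
Proof.
rewrite -big_mkcondr sum1_card => few.
have [/existsP[w /and3P[]]|/existsPn none] :=
  boolP [exists w, [&& w \in W, P w & w \notin p]]; first by exists w.
suff : #|[pred w in W | P w]| <= count [in W] p by rewrite leqNgt few.
rewrite -size_filter; apply: leq_trans (card_size _).
apply/subset_leq_card/fintype.subsetP => w; rewrite !inE mem_filter => /andP[wW Pw].
by have := none w; rewrite wW Pw /= negbK.
Qed.

(** Greedy construction, alternating between [A] and [W]. The next vertex of [W]
    must avoid all at most [2k] vertices used before. The next vertex of [A] must
    avoid only the used vertices that lie in [A]: at most [k] of them come from
    the [A] steps, and those of the [W] steps count only if [A] and [W] meet.
    This is what allows [s = k] for disjoint sets. *)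
Lemma alternating_path (T : finType) (e : rel T) (A W : {set T}) (u : T)
    (k s t : nat) :
  symmetric e -> 0 < #|A| ->
  (forall a, a \in A -> e u a) -> u \notin A -> u \notin W ->
  (forall a, a \in A -> t < \sum_(w in W) e a w) ->
  (forall w, w \in W -> s < \sum_(a in A) e a w) ->
  2 * k <= t -> k + k * ~~ [disjoint A & W] <= s ->
  exists p, [/\ path e u p, uniq (u :: p), size p = (2 * k).+1 & last u p \in A].
Proof.
move=> esym /card_gt0P[a0 a0A] uA uNA uNW dA dW.
have overlap w : w \in W -> (w \in A) <= ~~ [disjoint A & W].
  case: (boolP (w \in A)) => // wA wW.
  by rewrite lt0b; apply/pred0Pn; exists w; rewrite /= wA.
move: (nat_of_bool (~~ _)) overlap => d overlap.
(* The count of used vertices of [A] is the invariant that makes the bound [s]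
   suffice. *)
suff main i : 2 * i <= t -> i + i * d <= s ->
    exists p, [/\ path e u p, uniq (u :: p), size p = (2 * i).+1,
      last u p \in A & count [in A] p <= i.+1 + i * d].
  by move=> kt ks; have [p [? ? ? ? _]] := main k kt ks; exists p.
elim: i => [|i IHi] it is_.
  exists [:: a0]; rewrite /= uA // a0A inE; split=> //.
  by rewrite andbT; apply: contraNneq uNA => ->.
rewrite mulnS in it; rewrite mulSn in is_ *.
have [||p [pp up sp lp cp]] := IHi; [by clear -it; lia|by clear -is_; lia|].
set a := last u p in lp.
have [|w [wW aw wp]] := @fresh_neighbour _ (e a) W p.
  apply: leq_trans (dA _ lp); have := count_size [in W] p.
  by clear -sp it; lia.
have wA := overlap _ wW.
have [|b [bA wb bp]] := @fresh_neighbour _ (e^~ w) A (rcons p w).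
  apply: leq_trans (dW _ wW); rewrite -cats1 count_cat /=.
  by clear -cp is_ wA; lia.
exists (rcons (rcons p w) b); split.
- by rewrite !rcons_path pp last_rcons /= aw esym wb.
- move: up; rewrite -!rcons_cons !rcons_uniq /= => ->.
  rewrite -rcons_cons !(mem_rcons, inE) !negb_or wp andbT.
  move: bp; rewrite mem_rcons !inE !negb_or => /andP[-> ->]; rewrite !andbT.
  by apply/andP; split; [apply: contraNneq uNA => <-|apply: contraNneq uNW => <-].
- by rewrite !size_rcons sp mulnS.
- by rewrite last_rcons.
- rewrite -!cats1 !count_cat /= bA.
  by clear -cp wA; lia.
Qed.


(** * Squares of degrees in graphs without a cycle of length 2k + 2 *)

Lemma adj_sym (T : finType) (G : sgraph T) : symmetric (adj G).
Proof.
by move=> u v; have /andP[_ /forallP/(_ u)/forallP/(_ v)/eqP] := adj_pairsP G.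
Qed.

Lemma adj_irrefl (T : finType) (G : sgraph T) u : adj G u u = false.
Proof. by have /andP[/forallP/(_ u)/negbTE] := adj_pairsP G. Qed.

Lemma degreeE (T : finType) (G : sgraph T) u : degree G u = \sum_v adj G u v.
Proof. by rewrite /degree -big_mkcond -sum1_card; apply: eq_bigl => v; rewrite inE. Qed.

Lemma degree_le (T : finType) (G : sgraph T) u : degree G u <= #|T|.
Proof. exact: max_card. Qed.

Lemma closed_path_contains_cycle (T : finType) (G : sgraph T) (x : T) (c : seq T) :
  uniq (x :: c) -> cycle (adj G) (x :: c) -> contains_cycle (size c).+1 G.
Proof.
move=> uc /(pathP x) cc; rewrite size_rcons in cc.
set l := (size c).+1 in cc *.
have step i : i < l -> adj G (nth x (x :: c) i) (nth x (x :: c) (i.+1 %% l)).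
  move=> il; have := cc i il; rewrite -rcons_cons !nth_rcons_default.
  have [il'|] := ltnP i.+1 l; first by rewrite modn_small.
  move=> li; have -> : i.+1 = l by lia.
  by rewrite modnn [nth x c i]nth_default.
apply/existsP; exists [ffun i : 'I_l => nth x (x :: c) i]; apply/andP; split.
  apply/injectiveP => i j; rewrite !ffunE => /eqP; rewrite nth_uniq // => /eqP.
  exact: val_inj.
apply/forallP => i; apply/forallP => j; apply/implyP; rewrite !ffunE.
case/orP => /eqP; rewrite modn_small // => ->; last rewrite adj_sym; exact: step.
Qed.

Lemma edges_near_vertex (T : finType) (G : sgraph T) (k s t : nat) (u : T)
    (A W : {set T}) :
  ~~ contains_cycle (2 * k + 2) G -> (forall a, a \in A -> adj G u a) ->
  u \notin W -> 2 * k <= t -> k + k * ~~ [disjoint A & W] <= s ->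
  edges_between (adj G) A W <= s * #|W| + t * #|A|.
Proof.
move=> noC uA uW kt ks; rewrite leqNgt; apply: contra noC => /dense_core.
move=> [A' [W' [/fintype.subsetP sA /fintype.subsetP sW A'0 dA dW]]].
have [| | | |p [pp up sp lp]] := @alternating_path _ (adj G) A' W' u k s t
    (@adj_sym _ G) A'0 _ _ _ dA dW kt.
- by move=> a /sA/uA.
- by apply/negP => /sA/uA; rewrite adj_irrefl.
- by apply: contra uW; exact: sW.
- apply: leq_trans ks; rewrite leq_add2l leq_mul2l; apply/orP; right.
  have : [disjoint A & W] -> [disjoint A' & W'].
    by apply: disjointW; apply/fintype.subsetP.
  by case: [disjoint A & W] => [->|_] //; case: [disjoint _ & _].
have -> : 2 * k + 2 = (size p).+1 by lia.
apply: (@closed_path_contains_cycle _ _ u) => //.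
by rewrite /= rcons_path pp adj_sym uA // sA.
Qed.

(** Each neighbour [v] of [u] has its own edge to [u], its edges inside the
    neighbourhood [A] and its edges to the rest [B]. Only the last kind
    contributes a term linear in the order of the graph. *)
Lemma degree_sum_neighbours (T : finType) (G : sgraph T) (k : nat) (u : T) :
  ~~ contains_cycle (2 * k + 2) G ->
  \sum_(v | adj G u v) degree G v <= k * #|T| + (6 * k + 1) * degree G u.
Proof.
move=> noC; set A := [set v | adj G u v]; set B := ~: (u |: A).
have uA : u \notin A by rewrite inE adj_irrefl.
have split_deg v : v \in A ->
    degree G v = 1 + \sum_(w in A) adj G v w + \sum_(w in B) adj G v w.
  rewrite inE => uv; rewrite degreeE (bigID [in u |: A]) /= big_setU1 //=.
  rewrite adj_sym uv; congr (_ + _).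
  by apply: eq_bigl => w; rewrite /B finset.in_setC finset.in_setU.
have -> : \sum_(v | adj G u v) degree G v =
    #|A| + edges_between (adj G) A A + edges_between (adj G) A B.
  rewrite /edges_between -sum1_card -!big_split /=.
  by apply: eq_big => [v|v uv]; rewrite ?inE // split_deg // inE.
have inA a : a \in A -> adj G u a by rewrite inE.
have AA : edges_between (adj G) A A <= 2 * k * #|A| + 2 * k * #|A|.
  by apply: (edges_near_vertex noC inA uA) => //; case: [disjoint _ & _]; lia.
have AB : edges_between (adj G) A B <= k * #|B| + 2 * k * #|A|.
  apply: (edges_near_vertex noC inA _) => //; first by rewrite /B !inE eqxx.
  have -> : [disjoint A & B]; last by lia.
  by rewrite /B finset.disjoints_subset finset.setCK finset.subsetUr.
have cB : #|B| <= #|T| := max_card _; have -> : degree G u = #|A| by [].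
nia.
Qed.

(** Counting walks of length two by their middle vertex and by their first
    vertex gives the same number. *)
Lemma degree_square_sum (T : finType) (G : sgraph T) (k : nat) :
  ~~ contains_cycle (2 * k + 2) G ->
  \sum_u degree G u ^ 2 <= k * #|T| ^ 2 + (6 * k + 1) * \sum_u degree G u.
Proof.
move=> noC.
have -> : \sum_u degree G u ^ 2 = \sum_u \sum_(v | adj G u v) degree G v.
  rewrite (exchange_big_dep predT) //=; apply: eq_bigr => v _.
  rewrite sum_nat_const -mulnn; congr (_ * _).
  by apply: eq_card => u; rewrite !inE adj_sym.
have -> : k * #|T| ^ 2 = \sum_(u : T) k * #|T| by rewrite sum_nat_const -mulnn mulnCA.
rewrite big_distrr -big_split /=.
by apply: leq_sum => u _; exact: degree_sum_neighbours.
Qed.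

(** * The extremal example *)

Definition dominated_pairs (n k : nat) : {set 'I_n * 'I_n} :=
  [set uv : 'I_n * 'I_n | (uv.1 != uv.2) && ((uv.1 < k) || (uv.2 < k))].

Lemma dominated_pairs_simple n k : simple_adjacency (dominated_pairs n k).
Proof.
apply/andP; split; first by apply/forallP => u; rewrite inE eqxx.
by apply/forallP => u; apply/forallP => v; rewrite !inE /= (eq_sym u) orbC.
Qed.

Definition dominated_graph (n k : nat) : sgraph 'I_n :=
  SGraph (dominated_pairs_simple n k).

Lemma dominated_graphE n k u v :
  adj (dominated_graph n k) u v = (u != v) && ((u < k) || (v < k)).
Proof. by rewrite /adj /= inE. Qed.

(** The edges joining the cycle vertices [2 * i] and [2 * i + 1], for [i <= k],
    are disjoint and each has an end among the [k] dominating vertices. *)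
Lemma dominated_graph_no_cycle n k :
  ~~ contains_cycle (2 * k + 2) (dominated_graph n k).
Proof.
apply/existsP => -[f /andP[/injectiveP inj_f /forallP hom]].
have lt0 (i : 'I_k.+1) : 2 * i < 2 * k + 2 by have := ltn_ord i; lia.
have lt1 (i : 'I_k.+1) : (2 * i).+1 < 2 * k + 2 by have := ltn_ord i; lia.
(* [a] is the end of the [i]-th edge that is mapped to a dominating vertex. *)
have small (i : 'I_k.+1) : exists j : 'I_k, exists2 a : 'I_(2 * k + 2), j = f a :> nat & a./2 = i :> nat.
  have /forallP/(_ (Ordinal (lt1 i)))/implyP := hom (Ordinal (lt0 i)).
  rewrite dominated_graphE /cycle_adj /= eqxx => /(_ isT)/andP[_ /orP[]] fk.
    by exists (Ordinal fk), (Ordinal (lt0 i)) => //=; lia.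
  by exists (Ordinal fk), (Ordinal (lt1 i)) => //=; lia.
have {small} [g gP] := choice small.
suff /leq_card : injective g by rewrite !card_ord ltnn.
move=> i j gij; have [a ga ai] := gP i; have [b gb bj] := gP j.
apply: val_inj; rewrite /= -ai -bj; congr (_./2).
by congr nat_of_ord; apply/inj_f/val_inj; rewrite /= -ga -gb gij.
Qed.

Lemma dominated_graph_degree n k (u : 'I_n.+1) :
  u < k -> degree (dominated_graph n.+1 k) u = n.
Proof.
move=> uk; transitivity #|[set~ u]|; last by rewrite cardsC1 card_ord.
by apply: eq_card => v; rewrite !inE dominated_graphE uk andbT eq_sym.
Qed.

(** * Passage to real exponents and to the limit *)

Local Open Scope classical_set_scope.
Local Open Scope ring_scope.

(** Let [S] be the square sum, [D] the degree sum and [c = 6k + 1], so that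
    [S <= k * n ^ 2 + c * D]. The trivial bound [D <= n ^ 2] gives
    [S = O(n ^ 2)]; then [2 * sqrt n * d <= d ^ 2 + n], summed over the vertices,
    improves it to [D = O(n ^ (3/2))], which is inserted back. *)
Lemma degree_square_sum_bound (R : realType) (k n : nat) (G : sgraph 'I_n) :
  (0 < n)%N -> ~~ contains_cycle (2 * k + 2) G ->
  \sum_u (degree G u)%:R ^+ 2 <=
    n%:R ^+ 2 * (k%:R + ((6 * k + 1) * (7 * k + 2))%:R * Num.sqrt n%:R^-1) :> R.
Proof.
move=> n0 /degree_square_sum; rewrite card_ord.
set c := (6 * k + 1)%N => SD.
have degn u : (degree G u <= n)%N by rewrite -[leqRHS](card_ord n) degree_le.
have Dn : (\sum_u degree G u <= n * n)%N.
  apply: leq_trans (_ : \sum_(u < n) n <= _)%N; first exact: leq_sum.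
  by rewrite sum_nat_const card_ord.
set S := \sum_u _; set r : R := Num.sqrt n%:R; set D : R := \sum_u (degree G u)%:R.
have r0 : 0 < r by rewrite sqrtr_gt0 ltr0n.
have rr : r ^+ 2 = n%:R by rewrite sqr_sqrtr.
have {SD} SD : S <= k%:R * n%:R ^+ 2 + c%:R * D.
  move: SD; rewrite -(ler_nat R) natrD natrM natrX [(c * _)%:R]natrM !natr_sum.
  by under eq_bigr do rewrite natrX.
have {Dn} Dn : D <= n%:R ^+ 2 by move: Dn; rewrite -(ler_nat R) natrM natr_sum.
have rD : 2 * r * D <= S + n%:R ^+ 2.
  rewrite /D /S mulr_sumr.
  have -> : n%:R ^+ 2 = \sum_(u < n) n%:R :> R by rewrite sumr_const card_ord expr2 mulr_natr.
  rewrite -big_split /=; apply: ler_sum => u _; rewrite -rr.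
  by have := sqr_ge0 ((degree G u)%:R - r); lra.
have c0 : 0 <= c%:R :> R := ler0n R c.
have k0 : 0 <= k%:R :> R := ler0n R k.
have D0 : 0 <= D by apply: sumr_ge0.
have -> : (7 * k + 2 = k + c + 1)%N by rewrite /c; lia.
clearbody c; rewrite natrM !natrD.
have rD' : r * D <= (k%:R + c%:R + 1) * n%:R ^+ 2.
  have : 0 <= r * D by rewrite mulr_ge0 // ltW.
  have := ler_wpM2l c0 Dn; lra.
have rV : r * Num.sqrt n%:R^-1 = 1.
  by rewrite sqrtrV ?ler0n // mulfV // gt_eqF.
have DV : D <= (k%:R + c%:R + 1) * n%:R ^+ 2 * Num.sqrt n%:R^-1.
  have := ler_wpM2r (sqrtr_ge0 n%:R^-1) rD'.
  by rewrite mulrAC rV mul1r.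
apply: le_trans SD (le_trans (lerD (lexx _) (ler_wpM2l c0 DV)) _).
by rewrite le_eqVlt; apply/orP; left; apply/eqP; ring.
Qed.

Lemma degree_power_sum_le (R : realType) (p : R) (n : nat) (G : sgraph 'I_n) :
  2 <= p -> (0 < n)%N ->
  degree_power_sum p G <= n%:R `^ p * (n%:R ^- 2 * \sum_u (degree G u)%:R ^+ 2).
Proof.
move=> p2 n0; rewrite /degree_power_sum mulr_sumr mulr_sumr; apply: ler_sum => u _.
have p0 : 0 <= p - 2 by rewrite subr_ge0.
have n0' : n%:R != 0 :> R by rewrite pnatr_eq0 -lt0n.
have powS (x : R) : 0 < x -> x `^ p = x `^ (p - 2) * x ^+ 2.
  move=> x0; rewrite -powR_mulrn ?ltW // -powRD ?subrK //.
  by rewrite [x == 0]gt_eqF ?implybT.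
have [->|d0] := posnP (degree G u).
  rewrite powR0; last by rewrite gt_eqF //; lra.
  by rewrite !mulr_ge0 ?powR_ge0 ?invr_ge0 ?exprn_ge0.
rewrite !powS ?ltr0n // [leRHS]mulrA mulfK ?expf_neq0 // ler_wpM2r ?sqr_ge0 //.
have du : (degree G u <= n)%N.
  by rewrite -[leqRHS](card_ord n); exact: degree_le.
by apply: ge0_ler_powR; rewrite ?nnegrE ?ler0n // ler_nat.
Qed.

Lemma phi_upper (R : realType) (k n : nat) (p : R) :
  2 <= p -> (0 < n)%N ->
  phi k p n / n%:R `^ p <=
    k%:R + ((6 * k + 1) * (7 * k + 2))%:R * Num.sqrt n%:R^-1.
Proof.
move=> p2 n0; have n0' : 0 < n%:R :> R by rewrite ltr0n.
rewrite ler_pdivrMr ?powR_gt0 // mulrC.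
apply: bigmax_le => [|G noC].
  by rewrite mulr_ge0 ?powR_ge0 // addr_ge0 ?mulr_ge0 ?sqrtr_ge0.
apply: le_trans (degree_power_sum_le G p2 n0) _.
rewrite ler_wpM2l ?powR_ge0 // ler_pdivrMl ?exprn_gt0 //.
exact: degree_square_sum_bound.
Qed.

Lemma phi_lower (R : realType) (k n : nat) (p : R) :
  (k <= n.+1)%N -> k%:R * n%:R `^ p <= phi k p n.+1.
Proof.
move=> kn.
apply: le_trans (@le_bigmax_cond _ _ _ 0 (dominated_graph n.+1 k)
  (fun G => ~~ contains_cycle (2 * k + 2) G) _ (dominated_graph_no_cycle _ _)).
rewrite /degree_power_sum (bigID [pred u : 'I_n.+1 | (u < k)%N]) /=.
rewrite (eq_bigr (fun=> n%:R `^ p)); last by move=> u uk; rewrite dominated_graph_degree.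
have card_small : #|[pred u : 'I_n.+1 | (u < k)%N]| = k.
  rewrite -sum1_card -[RHS]card_ord -sum1_card (big_ord_widen _ (fun=> 1%N) kn).
  by apply: eq_bigl => u; rewrite inE.
rewrite sumr_const card_small mulr_natl lerDl.
by apply: sumr_ge0 => u _; exact: powR_ge0.
Qed.

Lemma cvg_sqrt_harmonic (R : realType) :
  (fun n => Num.sqrt (n.+1%:R^-1 : R)) @ \oo --> (0 : R).
Proof.
have := continuous_cvg _ (@sqrt_continuous R 0) (@cvg_harmonic R).
by rewrite sqrtr0; apply.
Qed.

Lemma cvg_powR_ratio (R : realType) (p : R) :
  (fun n => n%:R `^ p / n.+1%:R `^ p) @ \oo --> (1 : R).
Proof.
have cvg1 : (fun n => 1 - n.+1%:R^-1 : R) @ \oo --> (1 : R).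
  rewrite -[X in _ --> X]subr0; apply: cvgB; first exact: cvg_cst.
  exact: cvg_harmonic.
have cont : {for (1 : R), continuous (@powR R ^~ p)}.
  apply: differentiable_continuous; apply/derivable1_diffP.
  by have [] := is_derive1_powR p (ltr01 : (0 : R) < 1).
have := @continuous_cvg _ _ _ \oo _ _ (@powR R ^~ p) 1 cont cvg1; rewrite powR1 => cvgp.
apply: cvg_trans (cvgp _); apply: near_eq_cvg; near=> n => /=.
have -> : 1 - n.+1%:R^-1 = n%:R * n.+1%:R^-1 :> R.
  by rewrite -[X in X - _](@mulfV _ n.+1%:R) ?pnatr_eq0 // -[X in _ - X]mul1r -mulrBl -natr1 addrK.
by rewrite powRM ?invr_ge0 // -powR_inv1 // -powRrM mulN1r powRN.
Unshelve. all: by end_near. Qed.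

Theorem mainTheorem4 (R : realType) (p : R) (k : nat)
    (hp : 2 <= p) (hk : (1 <= k)%N) :
  (fun n : nat => phi k p n / n%:R `^ p) @ \oo --> (k%:R : R).
Proof.
rewrite -(cvg_shiftS _ (nbhs (k%:R : R))) /=.
set c : R := ((6 * k + 1) * (7 * k + 2))%:R.
apply: (@squeeze_cvgr _ _ _ _
  (fun n => k%:R * (n%:R `^ p / n.+1%:R `^ p))
  (fun n => k%:R + c * Num.sqrt n.+1%:R^-1)).
- near=> n; apply/andP; split; last exact: phi_upper.
  rewrite mulrA ler_pM2r ?invr_gt0 ?powR_gt0 //; apply: phi_lower.
  by apply: leqW; near: n; exact: nbhs_infty_ge.
- rewrite -[X in _ --> X]mulr1; apply: cvgM; [exact: cvg_cst|exact: cvg_powR_ratio].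
- rewrite -[X in _ --> X]addr0; apply: cvgD; first exact: cvg_cst.
  rewrite -[X in _ --> X](mulr0 c); apply: cvgM; [exact: cvg_cst|exact: cvg_sqrt_harmonic].
Unshelve. all: by end_near. Qed.
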